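(* For all integers $m,n\geq 2$, the categories $\mathcal{M}_{\mathfrak{sl}(m|n)}(1|1)$ and $\mathcal{M}^0_{\mathfrak{sl}(m|n)}(1|1)$ are empty; that is, there is no $\mathbb{Z}_2$-graded $\mathcal{U}(\mathfrak{sl}(m|n))$-module $M=M_{\bar 0}\oplus M_{\bar 1}$ such that $M_{\bar 0}$ and $M_{\bar 1}$ are each free of rank 1 over $\mathcal{U}(\mathfrak{h})$.
   Context: Everything is over $\mathbb{C}$. $\mathfrak{sl}(m|n)$ is the Lie superalgebra of supertraceless $(m+n)\times(m+n)$ matrices with rows and columns indexed by $\{1,\dots,m\}\cup\{\bar 1,\dots,\bar n\}$; $e_{IJ}$ are the matrix units, with $e_{ij},e_{\bar i\bar j}$ even and $e_{i\bar j},e_{\bar j i}$ odd, and $[x,y]=xy-(-1)^{|x||y|}yx$. The Cartan subalgebra $\mathfrak{h}$ (the diagonal matrices in $\mathfrak{sl}(m|n)$) has basis $h_i=e_{ii}+e_{\bar n\bar n}$ for $1\le i\le m$ and $h_{\bar j}=e_{\bar j\bar j}+e_{mm}$ for $1\le j\le n-1$, and $\mathcal{U}(\mathfrak{h})$ is the polynomial algebra in these elements. $\mathcal{M}_{\mathfrak{sl}(m|n)}(1|1)$ is the category of $\mathbb{Z}_2$-graded $\mathcal{U}(\mathfrak{sl}(m|n))$-modules (supermodules) whose even and odd parts are each free of rank 1 over $\mathcal{U}(\mathfrak{h})$; $\mathcal{M}^0_{\mathfrak{sl}(m|n)}(1|1)$ has the same objects but only even homomorphisms as morphisms. *)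

(* Defs.v *)
From HB Require Import structures.
From mathcomp Require Import all_boot all_order all_algebra.
From mathcomp Require Import generic_quotient ring_quotient boolp.
From mathcomp Require Import mpoly monalg.

Set Implicit Arguments.
Unset Strict Implicit.
Unset Printing Implicit Defensive.

Import GRing.Theory.
Local Open Scope ring_scope.

(* Rows and columns are indexed by 'I_(m + n): the indices below m stand for  *)
(* 1, .., m and the index m + j for \bar{j+1}. Parities are booleans, true    *)
(* being odd, so that addition of parities is (+).                            *)

Section SpecialLinear.
Variables (F : fieldType) (m n : nat).
Implicit Types X Y : 'M[F]_(m + n).

Definition ipar (i : 'I_(m + n)) : bool := (m <= i)%N.

Definition str X : F := \sum_i (-1) ^+ ipar i * X i i.

Definition hpart (a : bool) X : 'M[F]_(m + n) :=
  \matrix_(i, j) if ipar i (+) ipar j == a then X i j else 0.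

Definition supercomm X Y : 'M[F]_(m + n) :=
  \sum_a \sum_b (hpart a X *m hpart b Y
                 - (-1) ^+ (a && b) *: (hpart b Y *m hpart a X)).

Definition supertraceless : {pred 'M[F]_(m + n)} := [pred X | str X == 0].

Lemma str_is_linear a X Y : str (a *: X + Y) = a * str X + str Y.
Proof.
rewrite /str mulr_sumr -big_split; apply: eq_bigr => i _ /=.
by rewrite !mxE mulrDr mulrCA.
Qed.

Lemma supertraceless_submod : submod_closed supertraceless.
Proof.
split=> [|a X Y].
  by rewrite inE /str big1 // => i _; rewrite mxE mulr0.
by rewrite !inE str_is_linear => /eqP-> /eqP->; rewrite mulr0 addr0.
Qed.

HB.instance Definition _ :=
  GRing.isSubmodClosed.Build F 'M[F]_(m + n) supertraceless
    (GRing.submod_closed_semi supertraceless_submod).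
HB.instance Definition _ :=
  GRing.isOppClosed.Build 'M[F]_(m + n) supertraceless
    (GRing.zmod_closedN (GRing.submod_closedB supertraceless_submod)).

Record sl := Sl { slval :> 'M[F]_(m + n); slvalP : slval \in supertraceless }.

HB.instance Definition _ := [isSub for slval].
HB.instance Definition _ := [Choice of sl by <:].
HB.instance Definition _ := [SubChoice_isSubZmodule of sl by <:].
HB.instance Definition _ := [SubZmodule_isSubLmodule of sl by <:].

Definition sl_homog (a : bool) (x : sl) : Prop :=
  forall i j, ipar i (+) ipar j != a -> slval x i j = 0.

Lemma supercommE X Y i k : supercomm X Y i k =
  \sum_j (X i j * Y j k
    - (-1) ^+ ((ipar i (+) ipar j) && (ipar j (+) ipar k)) * (Y i j * X j k)).
Proof.
rewrite /supercomm summxE.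
under eq_bigr => a _ do rewrite summxE.
rewrite !big_bool /= !mxE !mulr_sumr -!sumrB -!big_split /=.
apply: eq_bigr => j _; rewrite !mxE.
case: (ipar i); case: (ipar j); case: (ipar k) => /=;
  rewrite ?(mul0r, mulr0, subr0, sub0r, addr0, add0r, oppr0, expr0, mul1r) //;
  by rewrite addrC.
Qed.

Lemma str_supercomm X Y : supercomm X Y \in supertraceless.
Proof.
rewrite inE /str; apply/eqP.
under eq_bigr => i _ do rewrite supercommE mulr_sumr.
have E i j : (-1) ^+ ipar i * (X i j * Y j i
    - (-1) ^+ ((ipar i (+) ipar j) && (ipar j (+) ipar i)) * (Y i j * X j i))
  = (-1) ^+ ipar i * (X i j * Y j i) - (-1) ^+ ipar j * (X j i * Y i j).
  rewrite [ipar j (+) _]addbC andbb mulrBr [X in _ - X]mulrA -signr_addb addKb.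
  by rewrite [Y i j * _]mulrC.
under eq_bigr => i _ do under eq_bigr => j _ do rewrite E.
under eq_bigr => i _ do rewrite sumrB.
by rewrite sumrB [X in X - _]exchange_big subrr.
Qed.

Definition sl_bracket (x y : sl) : sl := Sl (str_supercomm (slval x) (slval y)).

Definition emx (i j : nat) : 'M[F]_(m + n) :=
  \matrix_(r, s) ((r == i :> nat) && (s == j :> nat))%:R.

(* The basis of the Cartan subalgebra listed as h_1, .., h_m, h_{\bar 1}, ..,  *)
(* h_{\bar{n-1}}; (m + n).-1 is the index \bar n and m.-1 is the index m.      *)
Definition cartan_mx (k : 'I_(m + n).-1) : 'M[F]_(m + n) :=
  if (k < m)%N then emx k k + emx (m + n).-1 (m + n).-1
  else emx k k + emx m.-1 m.-1.

Lemma str_emx (i : 'I_(m + n)) : str (emx i i) = (-1) ^+ ipar i.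
Proof.
rewrite /str (bigD1 i) //= big1 => [|j neq_ji]; rewrite mxE ?eqxx ?mulr1 ?addr0 //.
by rewrite -(inj_eq val_inj) in neq_ji; rewrite (negPf neq_ji) mulr0.
Qed.

Lemma cartan_mx_in (k : 'I_(m + n).-1) :
  (0 < m)%N -> (0 < n)%N -> cartan_mx k \in supertraceless.
Proof.
move=> m_gt0 n_gt0; rewrite inE.
have mn_gt0 : (0 < m + n)%N by rewrite addn_gt0 m_gt0.
have ltk : (k < m + n)%N by rewrite (leq_trans (ltn_ord k)) ?leq_pred.
have ltl : ((m + n).-1 < m + n)%N by rewrite prednK.
have ltm : (m.-1 < m + n)%N by rewrite (leq_trans _ (leq_addr n m)) ?prednK.
have strD X Y : str (X + Y) = str X + str Y.
  by rewrite -{1}[X]scale1r str_is_linear mul1r.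
have := str_emx (Ordinal ltk); have := str_emx (Ordinal ltl).
have := str_emx (Ordinal ltm); rewrite /ipar /= /cartan_mx.
have -> : (m <= m.-1)%N = false by rewrite leqNgt prednK // leqnn.
have -> : (m <= (m + n).-1)%N by rewrite -ltnS prednK // -addn1 leq_add2l.
by case: (ltnP k m) => _ em el ek; rewrite strD ek ?el ?em ?subrr // addNr.
Qed.

(* insubd only supplies the (irrelevant) value 0 when m = 0 or n = 0, where   *)
(* the matrices above are not supertraceless.                                 *)
Definition cartan (k : 'I_(m + n).-1) : sl := insubd (0 : sl) (cartan_mx k).

Lemma slval_cartan (k : 'I_(m + n).-1) :
  (0 < m)%N -> (0 < n)%N -> slval (cartan k) = cartan_mx k.
Proof. by move=> m_gt0 n_gt0; rewrite /cartan insubdK //; exact: cartan_mx_in. Qed.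

End SpecialLinear.

Section Enveloping.
Variables (F : fieldType) (m n : nat).
Local Notation g := (sl F m n).

(* The free associative algebra on the set underlying sl(m|n); the relations  *)
(* env_lin below turn it into the tensor algebra.                             *)
Definition free_alg := {malg F[{fmonom g}]}.
HB.instance Definition _ := GRing.Lalgebra.on free_alg.

Definition fgen (x : g) : free_alg := mkmalgU (fmu x) 1.

Inductive env_ideal : free_alg -> Prop :=
| env_lin (a : F) (x y : g) :
    env_ideal (fgen (a *: x + y) - (a *: fgen x + fgen y))
| env_bracket (i j : bool) (x y : g) : sl_homog i x -> sl_homog j y ->
    env_ideal (fgen x * fgen y - (-1) ^+ (i && j) * (fgen y * fgen x)
               - fgen (sl_bracket x y))
| env_add u v : env_ideal u -> env_ideal v -> env_ideal (u + v)
| env_mull u v : env_ideal v -> env_ideal (u * v)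
| env_mulr u v : env_ideal u -> env_ideal (u * v).

Definition env_idealb : {pred free_alg} := fun u => `[< env_ideal u >].

Lemma env_idealP u : reflect (env_ideal u) (u \in env_idealb).
Proof. exact: asboolP. Qed.

Lemma env_ideal_zmod : zmod_closed env_idealb.
Proof.
split=> [|u v /env_idealP u_I /env_idealP v_I]; apply/env_idealP.
  by rewrite -(mul0r (fgen (1 *: 0 + 0) - (1 *: fgen 0 + fgen 0))); do 2!constructor.
by apply: env_add => //; rewrite -mulN1r; exact: env_mull.
Qed.

HB.instance Definition _ :=
  GRing.isZmodClosed.Build free_alg env_idealb env_ideal_zmod.

Lemma mcoeff1_fgen x : mcoeff mone (fgen x) = 0.
Proof. by rewrite mcoeffU fm1_eq1. Qed.

(* The augmentation sending all generators to 0 kills the ideal, so that the  *)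
(* quotient below is not the zero ring.                                       *)
Lemma env_ideal_aug u : env_ideal u -> mcoeff mone u = 0.
Proof.
elim=> {u} [a x y|i j x y _ _|u v _ u0 _ v0|u v _ v0|u v _ u0].
- by rewrite mcoeffB mcoeffD mcoeffZ !mcoeff1_fgen mulr0 addr0 subrr.
- by rewrite !mcoeffB !rmorphM /= !mcoeff1_fgen !(mulr0, subr0).
- by rewrite mcoeffD u0 v0 addr0.
- by rewrite rmorphM /= v0 mulr0.
- by rewrite rmorphM /= u0 mul0r.
Qed.

Lemma env_ideal1 : 1 \notin env_idealb.
Proof.
apply/env_idealP => /env_ideal_aug /eqP.
by rewrite mcoeff1 eqxx oner_eq0.
Qed.

(* U(sl(m|n)). The library makes the quotient by an ideal a ring only for      *)
(* commutative rings, so the multiplication is supplied here.                 *)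
Definition envsl := @Quotient.quot free_alg env_idealb.
HB.instance Definition _ := GRing.Zmodule.on envsl.
HB.instance Definition _ := EqQuotient.on envsl.

Definition epi (u : free_alg) : envsl := \pi_envsl%qT u.

Lemma epi_eq u v : epi u = epi v <-> env_ideal (u - v).
Proof.
split=> [/eqP|uv_I].
  by rewrite /epi -Quotient.idealrBE => /env_idealP.
by apply/eqP; rewrite /epi -Quotient.idealrBE; apply/env_idealP.
Qed.

Lemma epiK (x : envsl) : epi (repr x) = x.
Proof. exact: reprK. Qed.

Lemma epiD : {morph epi : u v / u + v}.
Proof. exact: Quotient.pi_add. Qed.

Definition env_one : envsl := epi 1.
Definition env_mul (x y : envsl) : envsl := epi (repr x * repr y).

Lemma epiM u v : epi (u * v) = env_mul (epi u) (epi v).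
Proof.
apply/epi_eq; set u' := repr _; set v' := repr _.
rewrite -[u * v](subrK (u * v')) -addrA -mulrBr -mulrBl.
have uI : env_ideal (u - u') by apply/epi_eq; rewrite epiK.
have vI : env_ideal (v - v') by apply/epi_eq; rewrite epiK.
by apply: env_add; [exact: env_mull | exact: env_mulr].
Qed.

Fact env_mulA : associative env_mul.
Proof.
by move=> x y z; rewrite -[x]epiK -[y]epiK -[z]epiK -!epiM mulrA.
Qed.
Fact env_mul1x : left_id env_one env_mul.
Proof. by move=> x; rewrite -[x]epiK -epiM mul1r. Qed.
Fact env_mulx1 : right_id env_one env_mul.
Proof. by move=> x; rewrite -[x]epiK -epiM mulr1. Qed.
Fact env_mulDl : left_distributive env_mul +%R.
Proof.
by move=> x y z; rewrite -[x]epiK -[y]epiK -[z]epiK -!(epiD, epiM) mulrDl.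
Qed.
Fact env_mulDr : right_distributive env_mul +%R.
Proof.
by move=> x y z; rewrite -[x]epiK -[y]epiK -[z]epiK -!(epiD, epiM) mulrDr.
Qed.
Fact env_one_neq0 : env_one != 0.
Proof.
apply/eqP; rewrite -[0]epiK => /epi_eq I1.
have /epi_eq I0 : epi (repr (0 : envsl)) = epi 0.
  by rewrite epiK -[LHS](addrK (epi 0)) add0r -{1}[0]addr0 epiD addrK.
move/env_idealP: env_ideal1; apply.
by have := env_add I1 I0; rewrite subr0 subrK.
Qed.

HB.instance Definition _ := GRing.Zmodule_isNzRing.Build envsl
  env_mulA env_mul1x env_mulx1 env_mulDl env_mulDr env_one_neq0.

Definition env_scal (c : F) : envsl := epi (c *: 1).
Definition env_gen (x : g) : envsl := epi (fgen x).

(* The Z_2-grading of U(sl(m|n)) induced by that of sl(m|n).                  *)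
Inductive env_homog : bool -> envsl -> Prop :=
| env_homog_gen i x : sl_homog i x -> env_homog i (env_gen x)
| env_homog_scal c : env_homog false (env_scal c)
| env_homogD i u v : env_homog i u -> env_homog i v -> env_homog i (u + v)
| env_homogM i j u v :
    env_homog i u -> env_homog j v -> env_homog (i (+) j) (u * v).

Record supermodule := SuperModule {
  smod :> lmodType envsl;
  spart : bool -> smod -> Prop;
  spart0 : forall i, spart i 0;
  spartD : forall i v w, spart i v -> spart i w -> spart i (v + w);
  spart_direct : forall v : smod, exists! w : smod * smod,
    [/\ spart false w.1, spart true w.2 & v = w.1 + w.2];
  spart_act : forall i j u v,
    env_homog i u -> spart j v -> spart (i (+) j) (u *: v)
}.

(* The inclusion U(h) -> U(sl(m|n)), U(h) being the polynomial algebra in the  *)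
(* (commuting) basis elements of the Cartan subalgebra.                       *)
Definition env_cartan (p : mpoly.mpoly (m + n).-1 F) : envsl :=
  mpoly.mmap env_scal (fun k => env_gen (@cartan F m n k)) p.

Definition free_rank1 (M : supermodule) (i : bool) : Prop :=
  exists2 v : M, spart i v &
    forall w : M, spart i w -> exists! p, w = env_cartan p *: v.

End Enveloping.

(* Main.v *)
From HB Require Import structures.
Require Import Defs.
From mathcomp Require Import all_boot all_order all_algebra.
From mathcomp Require Import reals complex.
From mathcomp Require Import boolp mpoly zify.
From mathcomp Require monalg.
Import (canonicals) monalg.
Set Implicit Arguments.
Unset Strict Implicit.
Unset Printing Implicit Defensive.
Import GRing.Theory.
Local Open Scope ring_scope.

(* An odd root vector x acts between M_0 and M_1 semilinearly with respect to a
   translation of U(h), and U(h) is a domain; hence x is either injective or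
   zero on each part.  As x^2 = 0, it kills at least one part, and as [x, x']
   is a nonzero element of h for the opposite root vector x', the two kill
   exactly one part each, and not the same one.  If x kills M_b and an odd y
   supercommutes with x, then x y = 0 on M_b, where x is injective on y M_b, so
   y kills M_b too.  Along the chain e_(m,1bar), e_(m,nbar), e_(1,nbar) the
   killed part is thus constant; but e_(nbar,1), opposite to the last of these,
   supercommutes with the first because m, n >= 2. *)

(** * Evaluation of polynomials at commuting elements of a noncommutative ring *)

Section CommutingEvaluation.
Variables (k : nat) (R : comNzRingType) (S : nzRingType).
Variables (f : {rmorphism R -> S}) (h : 'I_k -> S).
Hypothesis h_comm : forall i j, GRing.comm (h i) (h j).
Hypothesis f_comm : forall a i, GRing.comm (f a) (h i).

Lemma mmap1M_comm m1 m2 : mmap1 h (m1 + m2)%MM = mmap1 h m1 * mmap1 h m2.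
Proof.
rewrite /mmap1; under eq_bigr do rewrite mnmDE exprD.
by apply: prodrM_comm => i j _ _; apply/commrX/commr_sym/commrX/h_comm.
Qed.

(* The library's multiplicativity of mmap asks each h i to be central. *)
Lemma mmapM_comm : {morph mmap f h : p q / p * q}.
Proof.
elim/mpolyind => [|a m p _ _ IHp] q; first by rewrite !(mul0r, raddf0).
rewrite mulrDl !mmapD IHp mulrDl; congr (_ + _).
rewrite -scalerAl !mmapZ mmapX -mulrA; congr (_ * _).
elim/mpolyind: q => [|b l q _ _ IHq]; first by rewrite !(mulr0, raddf0).
rewrite mulrDr !mmapD IHq mulrDr; congr (_ + _).
rewrite -scalerAr -mpolyXD !mmapZ !mmapX mmap1M_comm !mulrA; congr (_ * _).
by apply: commr_prod => i _; apply: commrX.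
Qed.

End CommutingEvaluation.

(** For checking identities between ring morphisms, and commutation rules, on generators only. *)
Lemma mpoly_alg_ind k (R : nzRingType) (P : {mpoly R[k]} -> Prop) :
    (forall c, P c%:MP) -> (forall i, P 'X_i) ->
    (forall p q, P p -> P q -> P (p + q)) ->
    (forall p q, P p -> P q -> P (p * q)) ->
  forall p, P p.
Proof.
move=> PC PX PD PM; elim/mpolyind => [|c m p _ _ Pp]; first by rewrite -mpolyC0.
apply: (PD) => //; rewrite -mul_mpolyC; apply: (PM) => //; rewrite mpolyXE_id.
apply: big_ind => [|p1 p2|i _]; [by rewrite -mpolyC1; apply: PC | exact: PM |].
elim: (m i) => [|e IH]; first by rewrite expr0 -mpolyC1; apply: PC.
by rewrite exprS; apply: PM.
Qed.

(** * Translations of a polynomial ring *)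

Section Translation.
Variables (k : nat) (R : comNzRingType).

Definition translate (c : 'I_k -> R) : {mpoly R[k]} -> {mpoly R[k]} :=
  mmap (@mpolyC k R) (fun i => 'X_i - (c i)%:MP).

Lemma translateC c a : translate c a%:MP = a%:MP.
Proof. exact: mmapC. Qed.

Lemma translateX c i : translate c 'X_i = 'X_i - (c i)%:MP.
Proof. by rewrite /translate mmapX mmap1U. Qed.

Lemma translateD c : {morph translate c : p q / p + q}.
Proof. exact: mmapD. Qed.

Lemma translateM c : {morph translate c : p q / p * q}.
Proof. by move=> p q; rewrite /translate rmorphM. Qed.

(** Translation by the opposite vector is a left inverse. *)
Lemma translate_inj c : injective (translate c).
Proof.
apply: (can_inj (g := translate (fun i => - c i))).
elim/mpoly_alg_ind => [a|i|p q IHp IHq|p q IHp IHq].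
- by rewrite !translateC.
- by rewrite translateX translateD -rmorphN !(translateX, translateC) rmorphN opprK addrK.
- by rewrite !translateD IHp IHq.
- by rewrite !translateM IHp IHq.
Qed.

End Translation.

(** * Moving a weight vector past polynomials in the Cartan elements *)

Section Semicommutation.
Variables (k : nat) (R : comNzRingType) (S : nzRingType).
Variables (f : {rmorphism R -> S}) (h : 'I_k -> S) (c : 'I_k -> R) (x : S).
Hypothesis h_comm : forall i j, GRing.comm (h i) (h j).
Hypothesis f_comm : forall a y, GRing.comm (f a) y.
Hypothesis xh : forall i, x * h i = (h i - f (c i)) * x.

(** [xh], which says that [x] has weight [c], is the case of a variable; the rule passes to sums and
    products. *)
Lemma mmap_translate p : x * mmap f h p = mmap f h (translate c p) * x.
Proof.
have mmapM := mmapM_comm h_comm (fun a i => f_comm a (h i)).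
elim/mpoly_alg_ind: p => [a|i|p q IHp IHq|p q IHp IHq].
- by rewrite translateC !mmapC f_comm.
- by rewrite translateX mmapB mmapC !mmapX !mmap1U xh.
- by rewrite translateD !mmapD mulrDr IHp IHq mulrDl.
- by rewrite translateM !mmapM mulrA IHp -mulrA IHq mulrA.
Qed.

End Semicommutation.

(** Serves to deduce x^2 = 0 from [x, x] = 2 x^2 = 0 for an odd x. *)
Lemma double_eq0 (F : fieldType) (S : nzRingType) (f : {rmorphism F -> S}) (u : S) :
  (2%:R : F) != 0 -> u + u = 0 -> u = 0.
Proof.
move=> nz2 /(congr1 ( *%R (f 2%:R^-1))).
rewrite mulr0 mulrDr -mulrDl -rmorphD -mulr2n -[_ *+ 2]mulr_natr mulVf //.
by rewrite rmorph1 mul1r.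
Qed.

(** * Odd semilinear operators between two free parts of rank one *)

Section OddOperators.
Variables (A : idomainType) (S : nzRingType) (phi : A -> S).
Variables (V : lmodType S) (part : bool -> V -> Prop) (v : bool -> V).
Hypotheses (phi0 : phi 0 = 0) (phiM : {morph phi : p q / p * q}).
Hypotheses (part0 : forall b, part b 0) (v_part : forall b, part b (v b)).
Hypothesis v_free : forall b w, part b w -> exists! p, w = phi p *: v b.

(** [t] stands for the translation of U(h) by the weight of [x]; its injectivity enters as a trivial
    kernel. *)
Definition odd_semilinear (x : S) : Prop :=
  (forall b w, part b w -> part (~~ b) (x *: w)) /\
  exists t : A -> A,
    (forall p, t p = 0 -> p = 0) /\ (forall p, x * phi p = phi (t p) * x).

(** For an odd semilinear [x], vanishing on the generator means vanishing on the whole part, by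
    [kills_part]. *)
Definition kills (x : S) b : Prop := x *: v b = 0.

(** The zero vector also has coefficient 0, and coefficients are unique. *)
Lemma phi_free b p : phi p *: v b = 0 -> p = 0.
Proof.
have [q [_ q_uniq]] := v_free (part0 b) => p0.
by rewrite -(q_uniq p (esym p0)); apply: q_uniq; rewrite phi0 scale0r.
Qed.

Lemma kills_part x b w : odd_semilinear x -> kills x b -> part b w -> x *: w = 0.
Proof.
move=> [_ [t [_ xt]]] xv /v_free[p [-> _]].
by rewrite scalerA xt -scalerA xv scaler0.
Qed.

(** If w = p v_b and x v_b = q v_b', with b' the other parity, then x w = (t p) q v_b'. In a domain
    this vanishes only if t p or q does, and q is nonzero. *)
Lemma odd_semilinear_inj x b w : odd_semilinear x -> ~ kills x b ->
  part b w -> x *: w = 0 -> w = 0.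
Proof.
move=> [x_odd [t [t_inj xt]]] xv /v_free[p [-> _]].
have [q [xvE _]] := v_free (x_odd _ _ (v_part b)).
rewrite scalerA xt -scalerA xvE scalerA -phiM => /phi_free/eqP.
rewrite mulf_eq0 => /orP[] /eqP z; first by rewrite (t_inj _ z) phi0 scale0r.
by case: xv; rewrite /kills xvE z phi0 scale0r.
Qed.

Lemma square_zero_kills x b : odd_semilinear x -> x * x = 0 ->
  kills x b \/ kills x (~~ b).
Proof.
move=> x_odd xx; case: (EM (kills x (~~ b))) => xv; [by right | left].
apply: (odd_semilinear_inj x_odd xv); first by apply x_odd.1.
by rewrite scalerA xx scale0r.
Qed.

(** As x v_b = 0, the product x y acts on v_b as the nonzero [a]. So y v_b is nonzero, and [x] does
    not vanish on the other part, which contains it. *)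
Lemma opposite_kills x y a b : odd_semilinear x -> odd_semilinear y ->
    a != 0 -> x * y + y * x = phi a -> kills x b ->
  ~ kills x (~~ b) /\ ~ kills y b.
Proof.
move=> x_odd y_odd a0 xy xv.
have nz : x *: (y *: v b) <> 0.
  move=> e; case/eqP: a0; apply: (@phi_free b).
  by rewrite -xy scalerDl -!scalerA e xv scaler0 addr0.
split=> [xv'|yv]; apply: nz; last by rewrite yv scaler0.
by apply: (kills_part x_odd xv'); apply y_odd.1.
Qed.

Lemma anticommuting_kills x y b : odd_semilinear x -> odd_semilinear y ->
    x * y + y * x = 0 -> kills x b -> ~ kills x (~~ b) ->
  kills y b.
Proof.
move=> x_odd y_odd xy xv xv'.
apply: (odd_semilinear_inj x_odd xv'); first by apply y_odd.1.
have := congr1 ( *:%R^~ (v b)) xy.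
by rewrite scalerDl -!scalerA xv scaler0 addr0 scale0r.
Qed.

(** [y1], [y2], [y3] are opposite to [x1], [x2], [x3]. Being linked to [x1] as well, [y3] kills the
    same part as [x3], against [opposite_kills]. *)
Lemma no_odd_chain x1 x2 x3 y1 y2 y3 a1 a2 a3 :
    odd_semilinear x1 -> odd_semilinear x2 -> odd_semilinear x3 ->
    odd_semilinear y1 -> odd_semilinear y2 -> odd_semilinear y3 ->
    a1 != 0 -> a2 != 0 -> a3 != 0 ->
    x1 * y1 + y1 * x1 = phi a1 -> x2 * y2 + y2 * x2 = phi a2 ->
    x3 * y3 + y3 * x3 = phi a3 ->
    x1 * x1 = 0 -> x1 * x2 + x2 * x1 = 0 -> x2 * x3 + x3 * x2 = 0 ->
    x1 * y3 + y3 * x1 = 0 ->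
  False.
Proof.
move=> x1o x2o x3o y1o y2o y3o a1_0 a2_0 a3_0 xy1 xy2 xy3 sq1 x12 x23 x1y3.
have [b k1] : exists b, kills x1 b.
  by have [] := square_zero_kills false x1o sq1; eauto.
have [nk1 _] := opposite_kills x1o y1o a1_0 xy1 k1.
have k2 := anticommuting_kills x1o x2o x12 k1 nk1.
have [nk2 _] := opposite_kills x2o y2o a2_0 xy2 k2.
have k3 := anticommuting_kills x2o x3o x23 k2 nk2.
have [_ []] := opposite_kills x3o y3o a3_0 xy3 k3.
exact: (anticommuting_kills x1o y3o x1y3 k1 nk1).
Qed.

End OddOperators.

(** * Supercommutators of diagonal matrices and matrix units *)

Section MatrixBrackets.
Variables (F : fieldType) (m n : nat).
Implicit Types X Y : 'M[F]_(m + n).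

Lemma odd_neq (i j : 'I_(m + n)) : ipar i (+) ipar j -> i != j.
Proof. by apply: contraTneq => ->; rewrite addbb. Qed.

Definition mx_homog a X :=
  forall i j : 'I_(m + n), ipar i (+) ipar j != a -> X i j = 0.

Lemma supercomm_homog a b X Y : mx_homog a X -> mx_homog b Y ->
  supercomm X Y = X *m Y - (-1) ^+ (a && b) *: (Y *m X).
Proof.
move=> Xa Yb; apply/matrixP => p q; rewrite supercommE !mxE sumrB mulr_sumr.
congr (_ - _); apply: eq_bigr => r _.
case: (eqVneq (ipar p (+) ipar r) b) => [<-|/Yb->]; last by rewrite !mul0r !mulr0.
case: (eqVneq (ipar r (+) ipar q) a) => [<-|/Xa->]; last by rewrite !mulr0.
by rewrite andbC.
Qed.

Lemma delta_mx_homog (i j : 'I_(m + n)) :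
  mx_homog (ipar i (+) ipar j) (delta_mx i j).
Proof.
move=> p q; rewrite mxE.
by case: andP => [[/eqP-> /eqP->]|//]; rewrite eqxx.
Qed.

Lemma diag_mx_homog (d : 'rV[F]_(m + n)) : mx_homog false (diag_mx d).
Proof.
by move=> i j; rewrite mxE; case: (i =P j) => [->|//]; rewrite addbb.
Qed.

Lemma supercomm_diag (d e : 'rV[F]_(m + n)) :
  supercomm (diag_mx d) (diag_mx e) = 0.
Proof.
rewrite (supercomm_homog (@diag_mx_homog d) (@diag_mx_homog e)) scale1r.
by rewrite diag_mxC subrr.
Qed.

Lemma supercomm_diag_delta (d : 'rV[F]_(m + n)) i j :
  supercomm (diag_mx d) (delta_mx i j) = (d 0 i - d 0 j) *: delta_mx i j.
Proof.
rewrite (supercomm_homog (@diag_mx_homog d) (@delta_mx_homog i j)) scale1r.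
rewrite mul_diag_mx mul_mx_diag; apply/matrixP => p q; rewrite !mxE.
by case: andP => [[/eqP-> /eqP->]|_]; rewrite ?mulr1 ?mul1r // !mulr0 mul0r subrr.
Qed.

Lemma supercomm_delta_odd (i j k l : 'I_(m + n)) :
    ipar i (+) ipar j -> ipar k (+) ipar l ->
  supercomm (delta_mx i j) (delta_mx k l : 'M[F]_(m + n))
  = (j == k)%:R *: delta_mx i l + (l == i)%:R *: delta_mx k j.
Proof.
move=> ij kl.
rewrite (supercomm_homog (@delta_mx_homog i j) (@delta_mx_homog k l)) ij kl.
by rewrite expr1 scaleN1r opprK !mul_delta_mx_cond !scaler_nat.
Qed.

Lemma emx_delta (i j : 'I_(m + n)) : emx F m n i j = delta_mx i j.
Proof. by apply/matrixP => p q; rewrite !mxE. Qed.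

Lemma emx_offdiag k (i j : 'I_(m + n)) : i != j -> emx F m n k k i j = 0.
Proof.
move=> ij; rewrite mxE; case: andP => [[/eqP ik /eqP jk]|//].
by case/eqP: ij; apply: val_inj; rewrite /= ik jk.
Qed.

Lemma cartan_mx_diag (k : 'I_(m + n).-1) : exists d, cartan_mx F k = diag_mx d.
Proof.
apply/diag_mxP/is_diag_mxP => i j ij.
by rewrite /cartan_mx; case: ifP => _; rewrite mxE !emx_offdiag ?addr0.
Qed.

(** Treats both kinds of Cartan basis elements at once: [j] is the paired index, \bar n or m. *)
Lemma cartan_mx_sum (k : 'I_(m + n).-1) (i j : 'I_(m + n)) :
    k = i :> nat -> (if k < m then (m + n).-1 else m.-1)%N = j ->
  cartan_mx F k = delta_mx i i + delta_mx j j.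
Proof. by rewrite /cartan_mx -!emx_delta => ->; case: ifP => _ ->. Qed.

Lemma delta_mx_supertraceless (i j : 'I_(m + n)) :
  i != j -> delta_mx i j \in @supertraceless F m n.
Proof.
move=> ij; rewrite inE /str big1 // => k _; rewrite mxE.
by case: eqVneq => [->|_]; rewrite ?(negPf ij) mulr0.
Qed.

(* Junk value 0 for i = j. *)
Definition root_vec (i j : 'I_(m + n)) : sl F m n :=
  insubd (0 : sl F m n) (delta_mx i j).

Lemma slval_root_vec i j : i != j -> slval (root_vec i j) = delta_mx i j.
Proof. by move=> ij; rewrite /root_vec insubdK //; exact: delta_mx_supertraceless. Qed.

End MatrixBrackets.

(** * Scalars and defining relations in the enveloping algebra *)

Section EnvelopingRelations.
Variables (F : fieldType) (m n : nat).
Local Notation g := (sl F m n).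
Local Notation U := (envsl F m n).

Lemma epi0 : epi (0 : free_alg F m n) = 0.
Proof. by apply: (addrI (epi 0)); rewrite -epiD !addr0. Qed.

Lemma epiN : {morph @epi F m n : u / - u}.
Proof. by move=> u; apply/eqP; rewrite -addr_eq0 -epiD addNr epi0. Qed.

Lemma epi_mul : {morph @epi F m n : u v / u * v}.
Proof. exact: epiM. Qed.

Lemma env_scal_is_zmod : zmod_morphism (@env_scal F m n).
Proof. by move=> a b; rewrite /env_scal scalerBl epiD epiN. Qed.

Lemma env_scal_is_monoid : monoid_morphism (@env_scal F m n).
Proof.
split=> [|a b]; first by rewrite /env_scal scale1r.
by rewrite /env_scal -[RHS]epiM -scalerAl mul1r scalerA.
Qed.

HB.instance Definition _ := GRing.isZmodMorphism.Build F U (@env_scal F m n) env_scal_is_zmod.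
HB.instance Definition _ := GRing.isMonoidMorphism.Build F U (@env_scal F m n) env_scal_is_monoid.

(** Both sides expand over the support of [u], where coefficients commute and the unit monomial is
    neutral; centrality of scalars follows. *)
Lemma free_alg_mul_scal a (u : free_alg F m n) : u * (a *: 1) = a *: u.
Proof.
have E (v : free_alg F m n) :
    a *: v = monalg.mkmalgU (monalg.one : monalg.fmonom g) a * v.
  exact: esym (monalg.mul_malgC a v).
rewrite !E mulr1 !monalg.malgM_def monalg.fgmulgU monalg.fgmulUg.
by apply: eq_bigr => w _; rewrite mulrC monalg.mul1m monalg.mulm1.
Qed.

Lemma env_scalC a (u : U) : GRing.comm (env_scal m n a) u.
Proof.
rewrite -[u]epiK /GRing.comm; transitivity (epi (a *: repr u)).
  by rewrite -epi_mul -scalerAl mul1r.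
by rewrite -epi_mul free_alg_mul_scal.
Qed.

Lemma env_gen_linear a (x y : g) :
  env_gen (a *: x + y) = env_scal m n a * env_gen x + env_gen y.
Proof.
rewrite -epi_mul -epiD; apply/epi_eq; rewrite -scalerAl mul1r.
exact: env_lin.
Qed.

Lemma env_gen0 : env_gen (0 : g) = 0.
Proof.
have := env_gen_linear 1 (0 : g) 0.
rewrite scaler0 addr0 rmorph1 mul1r => e.
by apply: (addrI (env_gen 0)); rewrite addr0 -e.
Qed.

Lemma env_genZ a (x : g) : env_gen (a *: x) = env_scal m n a * env_gen x.
Proof. by rewrite -[a *: x]addr0 env_gen_linear env_gen0 addr0. Qed.

Lemma env_genM i j (x y : g) : sl_homog i x -> sl_homog j y ->
  env_gen x * env_gen y
  = (-1) ^+ (i && j) * (env_gen y * env_gen x) + env_gen (sl_bracket x y).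
Proof.
(* The sign lives in the free algebra in [env_bracket], but in the quotient here. *)
move=> xi yj; have e : epi ((-1) ^+ (i && j)) = (-1) ^+ (i && j) :> U.
  by case: (i && j); [rewrite !expr1 epiN | rewrite !expr0].
rewrite -e; transitivity (epi ((-1) ^+ (i && j) * (fgen y * fgen x) + fgen (sl_bracket x y))).
  rewrite -epi_mul; apply/epi_eq; rewrite opprD addrA; exact: env_bracket.
by rewrite epiD !epi_mul.
Qed.

End EnvelopingRelations.

(** * Cartan elements and root vectors in the enveloping algebra *)

Section CartanAndRoots.
Variables (F : fieldType) (m n : nat).
Hypotheses (m_gt0 : (0 < m)%N) (n_gt0 : (0 < n)%N).
Local Notation U := (envsl F m n).
Local Notation h := (fun k => env_gen (cartan F k) : U).
Local Notation x := (fun i j : 'I_(m + n) => env_gen (root_vec F i j) : U).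

Lemma cartan_homog k : sl_homog false (@cartan F m n k).
Proof.
by have [d e] := cartan_mx_diag F k; move=> i j; rewrite slval_cartan // e => /diag_mx_homog.
Qed.

Lemma root_vec_homog i j : i != j -> sl_homog (ipar i (+) ipar j) (@root_vec F m n i j).
Proof. by move=> ij p q; rewrite slval_root_vec // => /delta_mx_homog->. Qed.

Lemma env_cartan_comm k l : GRing.comm (h k) (h l).
Proof.
rewrite /GRing.comm (env_genM (@cartan_homog k) (@cartan_homog l)) mul1r.
suff -> : sl_bracket (cartan F k) (cartan F l) = 0 by rewrite env_gen0 addr0.
apply: val_inj; rewrite /= !slval_cartan //.
by have [d ->] := cartan_mx_diag F k; have [e ->] := cartan_mx_diag F l; exact: supercomm_diag.
Qed.

Lemma env_cartanM : {morph @env_cartan F m n : p q / p * q}.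
Proof. by apply: mmapM_comm => *; [exact: env_cartan_comm | exact: env_scalC]. Qed.

Lemma env_cartanX k : env_cartan 'X_k = h k.
Proof. by rewrite /env_cartan mmapX mmap1U. Qed.

Lemma env_cartan0 : env_cartan 0 = 0 :> U.
Proof. exact: mmap0. Qed.

(** The root of e_ij evaluated at the k-th Cartan basis element. *)
Definition root_weight (i j : 'I_(m + n)) (k : 'I_(m + n).-1) : F :=
  cartan_mx F k i i - cartan_mx F k j j.

(** From [h_k, e_ij] = alpha(h_k) e_ij, with alpha the root of e_ij. *)
Lemma env_root_cartan i j p : i != j ->
  x i j * env_cartan p = env_cartan (translate (root_weight i j) p) * x i j.
Proof.
move=> ij; apply: mmap_translate => [k l|a u|k].
- exact: env_cartan_comm.
- exact: env_scalC.
rewrite mulrBl; apply/eqP; rewrite -subr_eq opprK; apply/eqP.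
rewrite (env_genM (cartan_homog k) (root_vec_homog ij)) expr0 mul1r.
congr (_ + _); rewrite -env_genZ; congr env_gen; apply: val_inj.
rewrite /= slval_cartan // slval_root_vec // /root_weight.
have [d ->] := cartan_mx_diag F k.
by rewrite supercomm_diag_delta !mxE !eqxx.
Qed.

Lemma env_root_supercomm (i j k l : 'I_(m + n)) :
    ipar i (+) ipar j -> ipar k (+) ipar l ->
  x i j * x k l + x k l * x i j
  = env_gen (sl_bracket (root_vec F i j) (root_vec F k l)).
Proof.
move=> ij kl.
rewrite (env_genM (root_vec_homog (odd_neq ij)) (root_vec_homog (odd_neq kl))).
by rewrite ij kl expr1 mulN1r addrC addNKr.
Qed.

Lemma env_root_anticomm (i j k l : 'I_(m + n)) :
    ipar i (+) ipar j -> ipar k (+) ipar l -> j != k -> l != i ->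
  x i j * x k l + x k l * x i j = 0.
Proof.
move=> ij kl jk li; rewrite env_root_supercomm //.
suff -> : sl_bracket (root_vec F i j) (root_vec F k l) = 0 by rewrite env_gen0.
apply: val_inj; rewrite /= !slval_root_vec ?odd_neq // supercomm_delta_odd //.
by rewrite (negPf jk) (negPf li) !scale0r addr0.
Qed.

(** For odd e_ij the bracket with e_ji is e_ii + e_jj, with a plus sign, which is the shape of the
    Cartan basis elements. *)
Lemma env_root_opp (i j : 'I_(m + n)) k :
    ipar i (+) ipar j -> cartan_mx F k = delta_mx i i + delta_mx j j ->
  x i j * x j i + x j i * x i j = env_gen (cartan F k).
Proof.
move=> ij hk; have ji : ipar j (+) ipar i by rewrite addbC.
rewrite env_root_supercomm //; congr env_gen; apply: val_inj.
rewrite /= slval_cartan // hk !slval_root_vec ?odd_neq //.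
by rewrite supercomm_delta_odd // !eqxx !scale1r.
Qed.

Lemma env_root_sqr (i j : 'I_(m + n)) : (2%:R : F) != 0 -> ipar i (+) ipar j ->
  x i j * x i j = 0.
Proof.
move=> nz2 ij; have := @env_root_anticomm i j i j ij ij.
rewrite eq_sym odd_neq // => /(_ isT isT); exact: (double_eq0 (env_scal m n)).
Qed.

Lemma env_root_odd_semilinear (M : supermodule F m n) (i j : 'I_(m + n)) :
  ipar i (+) ipar j -> odd_semilinear (@env_cartan F m n) (@spart F m n M) (x i j).
Proof.
move=> ij; split=> [b w wb|].
  rewrite -addTb; apply: spart_act wb.
  by rewrite -ij; apply/env_homog_gen/root_vec_homog/odd_neq.
exists (translate (root_weight i j)); split=> [p|p].
  by move=> e; apply: (@translate_inj _ _ (root_weight i j)); rewrite e -mpolyC0 translateC.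
by apply: env_root_cartan => //; exact: odd_neq.
Qed.

End CartanAndRoots.

(** * The contradictory chain of odd root vectors in sl(m|n) *)

Theorem no_free_rank1_supermodule (F : fieldType) (m n : nat) :
    (2%:R : F) != 0 -> (2 <= m)%N -> (2 <= n)%N ->
  ~ exists M : supermodule F m n, free_rank1 M false /\ free_rank1 M true.
Proof.
move=> nz2 m2 n2 [M [[v0 v0p v0f] [v1 v1p v1f]]].
have m0 := ltnW m2; have n0 := ltnW n2.
pose v b : M := if b then v1 else v0.
have vp b : spart b (v b) by case: b.
have vf b (w : M) : spart b w -> exists! p, w = env_cartan p *: v b.
  by case: b; [exact: v1f | exact: v0f].
have lt1 : (0 < m + n)%N by lia.
have lt2 : (m.-1 < m + n)%N by lia.
have lt3 : (m < m + n)%N by lia.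
have lt4 : ((m + n).-1 < m + n)%N by lia.
(* Positions of h_1, h_m and h_{\bar 1} in the Cartan basis, which omits \bar n; the last bound uses
   n >= 2. *)
have lt1' : (0 < (m + n).-1)%N by lia.
have lt2' : (m.-1 < (m + n).-1)%N by lia.
have lt3' : (m < (m + n).-1)%N by lia.
(* Counting from 0, these are the indices 1, m, \bar 1 and \bar n. *)
pose i1 := Ordinal lt1; pose i2 := Ordinal lt2.
pose j1 := Ordinal lt3; pose j2 := Ordinal lt4.
have i1p : ipar i1 = false by rewrite /ipar /=; lia.
have i2p : ipar i2 = false by rewrite /ipar /=; lia.
have j1p : ipar j1 by rewrite /ipar /=; lia.
have j2p : ipar j2 by rewrite /ipar /=; lia.
have i2j1 : ipar i2 (+) ipar j1 by rewrite i2p j1p.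
have i2j2 : ipar i2 (+) ipar j2 by rewrite i2p j2p.
have i1j2 : ipar i1 (+) ipar j2 by rewrite i1p j2p.
have j2i1 : ipar j2 (+) ipar i1 by rewrite i1p j2p.
(* The brackets of e_{m,\bar 1}, e_{m,\bar n}, e_{1,\bar n} with their transposes are the basis
   elements h_{\bar 1}, h_m, h_1, hence variables of U(h). *)
have h1 : cartan_mx F (Ordinal lt3') = delta_mx i2 i2 + delta_mx j1 j1.
  by rewrite addrC; apply: cartan_mx_sum => //=; rewrite ltnn.
have h2 : cartan_mx F (Ordinal lt2') = delta_mx i2 i2 + delta_mx j2 j2.
  by apply: cartan_mx_sum => //=; case: ifP => //; lia.
have h3 : cartan_mx F (Ordinal lt1') = delta_mx i1 i1 + delta_mx j2 j2.
  by apply: cartan_mx_sum => //=; case: ifP => //; lia.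
have X0 k : ('X_k : mpoly (m + n).-1 F) != 0 by rewrite -msize_poly_eq0 msizeX.
have x_odd i j ij := @env_root_odd_semilinear F m n m0 n0 M i j ij.
have j1i2 : ipar j1 (+) ipar i2 by rewrite addbC.
have j2i2 : ipar j2 (+) ipar i2 by rewrite addbC.
apply: (no_odd_chain (@env_cartan0 F m n) (env_cartanM m0 n0) (@spart0 _ _ _ M) vp vf
  (x_odd i2 j1 i2j1) (x_odd i2 j2 i2j2) (x_odd i1 j2 i1j2)
  (x_odd j1 i2 j1i2) (x_odd j2 i2 j2i2) (x_odd j2 i1 j2i1) (X0 _) (X0 _) (X0 _)).
- by rewrite env_cartanX; exact: (env_root_opp m0 n0 i2j1 h1).
- by rewrite env_cartanX; exact: (env_root_opp m0 n0 i2j2 h2).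
- by rewrite env_cartanX; exact: (env_root_opp m0 n0 i1j2 h3).
- exact: env_root_sqr.
- by apply: env_root_anticomm => //; apply/eqP => /(congr1 val) /=; lia.
- by apply: env_root_anticomm => //; apply/eqP => /(congr1 val) /=; lia.
(* e_{m,\bar 1} against e_{\bar n,1}: this needs \bar 1 and \bar n distinct, and 1 and m distinct,
   hence n, m >= 2. *)
- by apply: env_root_anticomm => //; apply/eqP => /(congr1 val) /=; lia.
Qed.

(** The two categories share their objects, so one statement covers both; [R[i]] is the complex
    field over a model [R] of the reals. *)
Theorem mainTheorem8 (R : realType) (m n : nat) :
  (2 <= m)%N -> (2 <= n)%N ->
  ~ exists M : supermodule R[i] m n, free_rank1 M false /\ free_rank1 M true.
Proof. by apply: no_free_rank1_supermodule; rewrite Num.Theory.pnatr_eq0. Qed.
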